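(* Let $R$ be a finite set of step clauses and $\Diamond l$ an eventuality ($l$ a literal). There is a loop in $\neg l$ within $R$ if and only if the naive loop-detection algorithm, run on $R$ and $l$, outputs a non-empty set of SNF$_m$ clauses.
   Context: Literals are proposition symbols or their negations. A step clause is a formula $\bigwedge_a k_a\Rightarrow\bigcirc\bigvee_d l_d$ with literals $k_a,l_d$ ($\bigcirc$ = ''next''). SNF$_m$ clauses: every step clause is an SNF$_m$ clause, and from SNF$_m$ clauses $A\Rightarrow\bigcirc C$ and $B\Rightarrow\bigcirc D$ one forms the SNF$_m$ clause $(A\wedge B)\Rightarrow\bigcirc(C\wedge D)$ (merging); thus every nonempty subset of $R$ merges into one SNF$_m$ clause whose left side is the conjunction of the left sides and whose right side is $\bigcirc$ of the conjunction of the right sides. A loop in $\neg l$ within $R$ is a non-empty finite set of SNF$_m$ clauses $A_i\Rightarrow\bigcirc B_i$ ($0\le i\le n$), each obtained by merging clauses of $R$, such that for every $i$ both $B_i\Rightarrow\neg l$ and $B_i\Rightarrow\bigvee_{j=0}^nA_j$ are classical propositional tautologies (the $A_i,B_i$ being regarded as propositional formulae). Naive algorithm: (1) let $R^*$ be the set of SNF$_m$ clauses obtained by merging the clauses of each nonempty subset of $R$; (2) delete from $R^*$ every clause $X_i\Rightarrow\bigcirc Y_i$ such that $Y_i\Rightarrow\neg l$ is not a tautology; (3) delete from $R^*$ every clause $X_i\Rightarrow\bigcirc Y_i$ such that $Y_i\Rightarrow\bigvee_j X_j$ is not a tautology, where $X_j$ ranges over the left-hand sides of the clauses currently in $R^*$;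 (4) repeat (3) until no more clauses can be deleted, and output the remaining set. *)

(* Defs.v *)
From HB Require Import structures.
From mathcomp Require Import all_boot.
From mathcomp Require Import finmap.

Set Implicit Arguments.
Unset Strict Implicit.
Unset Printing Implicit Defensive.

Local Open Scope fset_scope.

Inductive form (P : Type) : Type :=
| FTrue
| FFalse
| FVar of P
| FNot of form P
| FAnd of form P & form P
| FOr of form P & form P
| FImp of form P & form P.

Arguments FTrue {P}.
Arguments FFalse {P}.

Section FormChoice.
Variable P : Type.

Fixpoint form_code (f : form P) : GenTree.tree P :=
  match f with
  | FTrue => GenTree.Node 0 [::]
  | FFalse => GenTree.Node 1 [::]
  | FVar p => GenTree.Leaf p
  | FNot f => GenTree.Node 2 [:: form_code f]
  | FAnd f g => GenTree.Node 3 [:: form_code f; form_code g]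
  | FOr f g => GenTree.Node 4 [:: form_code f; form_code g]
  | FImp f g => GenTree.Node 5 [:: form_code f; form_code g]
  end.

Fixpoint form_decode (t : GenTree.tree P) : option (form P) :=
  match t with
  | GenTree.Node 0 [::] => Some FTrue
  | GenTree.Node 1 [::] => Some FFalse
  | GenTree.Leaf p => Some (FVar p)
  | GenTree.Node 2 [:: t] => omap (@FNot P) (form_decode t)
  | GenTree.Node 3 [:: t; u] =>
      obind (fun f => omap (FAnd f) (form_decode u)) (form_decode t)
  | GenTree.Node 4 [:: t; u] =>
      obind (fun f => omap (FOr f) (form_decode u)) (form_decode t)
  | GenTree.Node 5 [:: t; u] =>
      obind (fun f => omap (FImp f) (form_decode u)) (form_decode t)
  | _ => None
  end.

Lemma form_codeK : pcancel form_code form_decode.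
Proof.
by elim=> //= [f -> | f -> g -> | f -> g -> | f -> g ->].
Qed.

End FormChoice.

HB.instance Definition _ (P : choiceType) :=
  Choice.copy (form P) (pcan_type (@form_codeK P)).

Section Semantics.
Variable P : choiceType.
Implicit Types (f : form P) (v : P -> bool).

Fixpoint eval v f : bool :=
  match f with
  | FTrue => true
  | FFalse => false
  | FVar p => v p
  | FNot f => ~~ eval v f
  | FAnd f g => eval v f && eval v g
  | FOr f g => eval v f || eval v g
  | FImp f g => eval v f ==> eval v g
  end.

Definition tautology f : Prop := forall v, eval v f.

Fixpoint atoms f : {fset P} :=
  match f with
  | FTrue | FFalse => fset0
  | FVar p => [fset p]
  | FNot f => atoms f
  | FAnd f g | FOr f g | FImp f g => atoms f `|` atoms g
  end.

(* Truth-table test: a set S of atoms of f stands for the valuation that makes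
   exactly the elements of S true. *)
Definition tautb f : bool :=
  all (fun S : {fset P} => eval (fun p => p \in S) f) (fpowerset (atoms f)).

Lemma eq_eval v w f : {in atoms f, v =1 w} -> eval v f = eval w f.
Proof.
elim: f => //= [p | f IHf | f IHf g IHg | f IHf g IHg | f IHf g IHg] vw.
- by apply: vw; rewrite inE.
- by rewrite IHf.
- by rewrite IHf ?IHg // => p pf; apply: vw; rewrite inE pf ?orbT.
- by rewrite IHf ?IHg // => p pf; apply: vw; rewrite inE pf ?orbT.
- by rewrite IHf ?IHg // => p pf; apply: vw; rewrite inE pf ?orbT.
Qed.

Lemma tautP f : reflect (tautology f) (tautb f).
Proof.
apply: (iffP allP) => [Tf v | Tf S _]; last exact: Tf.
have /Tf : [fset p in atoms f | v p] \in fpowerset (atoms f).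
  by rewrite fpowersetE; apply/fsubsetP => p; rewrite !inE => /andP[].
by rewrite (@eq_eval _ v) // => p pf; rewrite !inE pf.
Qed.

(* For a non-empty sequence no unit is added: [:: A; B; C] gives (A /\ B) /\ C,
   and [:: A] gives A itself. *)
Definition conj_seq (s : seq (form P)) : form P :=
  if s is f :: s' then foldl (@FAnd P) f s' else FTrue.

Definition disj_seq (s : seq (form P)) : form P :=
  if s is f :: s' then foldl (@FOr P) f s' else FFalse.

End Semantics.

(* (true, p) is the literal p and (false, p) the literal ~ p. *)
Definition literal (P : choiceType) : choiceType := (bool * P)%type.

(* (ks, ls) is the clause  /\ ks => next (\/ ls). *)
Definition step_clause (P : choiceType) : choiceType :=
  (seq (literal P) * seq (literal P))%type.

(* (A, B) is the clause  A => next B. *)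
Definition snfm (P : choiceType) : choiceType := (form P * form P)%type.

Section Loops.
Variable P : choiceType.
Implicit Types (l : literal P) (c : step_clause P) (C D : snfm P).
Implicit Types (R S : {fset step_clause P}) (L X : {fset snfm P}).

Definition lit_form l : form P := if l.1 then FVar l.2 else FNot (FVar l.2).

Definition snfm_of_step c : snfm P :=
  (conj_seq [seq lit_form k | k <- c.1], disj_seq [seq lit_form d | d <- c.2]).

Definition merge C D : snfm P := (FAnd C.1 D.1, FAnd C.2 D.2).

Inductive merged R : snfm P -> Prop :=
| merged_step c : c \in R -> merged R (snfm_of_step c)
| merged_merge C D : merged R C -> merged R D -> merged R (merge C D).

Definition rhs_false l C : form P := FImp C.2 (FNot (lit_form l)).

Definition rhs_covered L C : form P :=
  FImp C.2 (disj_seq [seq D.1 | D : snfm P <- L]).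

Definition is_loop R l L : Prop :=
  [/\ L != fset0,
      forall C, C \in L -> merged R C &
      forall C, C \in L ->
        tautology (rhs_false l C) /\ tautology (rhs_covered L C)].

(* Merging all clauses of S, in the order in which S is enumerated; only used
   for S != fset0. *)
Definition merge_set S : snfm P :=
  (conj_seq [seq (snfm_of_step c).1 | c : step_clause P <- S],
   conj_seq [seq (snfm_of_step c).2 | c : step_clause P <- S]).

Definition all_merges R : {fset snfm P} :=
  [fset merge_set S | S in fpowerset R `\ fset0].

Definition filter_rhs l X : {fset snfm P} :=
  [fset C in X | tautb (rhs_false l C)].

(* One pass: all tests refer to the set at the start of the pass. *)
Definition prune X : {fset snfm P} := [fset C in X | tautb (rhs_covered X C)].

Lemma prune_stable X : exists k, prune (iter k prune X) == iter k prune X.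
Proof.
elim: {X}_.+1 {-2}X (ltnSn #|` X|) => // n IHn X leXn.
have sub : prune X `<=` X by apply/fsubsetP => C; rewrite !inE => /andP[].
have [eqX | neqX] := eqVneq (prune X) X; first by exists 0; rewrite /= eqX.
have /IHn[k Hk] : #|` prune X| < n.
  by apply: leq_trans (leXn : _ <= n); apply: fproper_ltn_card;
     rewrite fproperEneq neqX.
by exists k.+1; rewrite iterSr.
Qed.

(* Iterate until the first pass that deletes nothing. *)
Definition prune_all X : {fset snfm P} :=
  iter (ex_minn (prune_stable X)) prune X.

Definition naive_loop R l : {fset snfm P} :=
  prune_all (filter_rhs l (all_merges R)).

End Loops.

(* Main.v *)
Require Import Defs.
From mathcomp Require Import all_boot.
From mathcomp Require Import finmap.

(** Up to propositional equivalence of both sides, the clauses obtained by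
    merging clauses of [R] are exactly those of [all_merges R]. A surviving set
    of the algorithm is thus itself a loop; conversely, if every clause of a
    loop has an equivalent among the current clauses, then pruning deletes none
    of these equivalents, so they all survive. *)

Set Implicit Arguments.
Unset Strict Implicit.
Unset Printing Implicit Defensive.

Local Open Scope fset_scope.

Lemma all_fset1 (T : choiceType) (a : pred T) (x : T) : all a [fset x] = a x.
Proof.
apply/allP/idP => [ax | ax y]; first by apply: ax; rewrite inE.
by rewrite inE => /eqP ->.
Qed.

Lemma all_fsetU (T : choiceType) (a : pred T) (A B : {fset T}) :
  all a (A `|` B) = all a A && all a B.
Proof.
apply/allP/andP => [aAB | [/allP aA /allP aB] x].
  by split; apply/allP => x xAB; apply: aAB; rewrite inE xAB ?orbT.
by rewrite inE => /orP[/aA | /aB].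
Qed.

Section Loops.
Variable P : choiceType.
Implicit Types (v : P -> bool) (l : literal P) (c : step_clause P).
Implicit Types (C D : snfm P) (R S : {fset step_clause P}).
Implicit Types (L X : {fset snfm P}) (s : seq (form P)).

Lemma eval_conj_seq v s : eval v (conj_seq s) = all (eval v) s.
Proof.
case: s => //= f s; elim: s f => [|g s IHs] f /=; first by rewrite andbT.
by rewrite IHs andbA.
Qed.

Lemma eval_disj_seq v s : eval v (disj_seq s) = has (eval v) s.
Proof.
case: s => //= f s; elim: s f => [|g s IHs] f /=; first by rewrite orbF.
by rewrite IHs orbA.
Qed.

Lemma eval_rhs_covered v L C :
  eval v (rhs_covered L C) = (eval v C.2 ==> has (fun D => eval v D.1) L).
Proof. by rewrite -has_map -eval_disj_seq. Qed.

(** The choice of [D] may depend on the valuation: no single left-hand side has to follow from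
    [C.2]. *)
Lemma rhs_coveredP L C :
  tautology (rhs_covered L C) <->
  (forall v, eval v C.2 -> exists2 D, D \in L & eval v D.1).
Proof.
split=> [tC v C2 | covC v].
  by have := tC v; rewrite eval_rhs_covered C2 => /hasP.
by rewrite eval_rhs_covered; apply/implyP => /covC/hasP.
Qed.

(** Syntactic equality would be too strong: a merge may repeat clauses and nest them in any order,
    while [merge_set] takes each clause once, in enumeration order. *)
Definition snfm_equiv C D :=
  forall v, eval v C.1 = eval v D.1 /\ eval v C.2 = eval v D.2.

Lemma eval_merge_set v S :
  (eval v (merge_set S).1 = all (fun c => eval v (snfm_of_step c).1) S) *
  (eval v (merge_set S).2 = all (fun c => eval v (snfm_of_step c).2) S).
Proof. by rewrite !eval_conj_seq !all_map. Qed.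

Lemma all_mergesP R C :
  reflect (exists S, [/\ S `<=` R, S != fset0 & C = merge_set S])
          (C \in all_merges R).
Proof.
rewrite /all_merges; apply: (iffP (imfsetP _ _ _ _)) => [[S /= SR ->] | [S [SR S0 ->]]]; exists S => //=.
  by move: SR; rewrite !inE fpowersetE => /andP[].
by rewrite !inE fpowersetE S0.
Qed.

(** Induction on the merge, tracking the set of step clauses used: a singleton at a leaf, a union at
    a merge. Overlaps are harmless because conjunction is idempotent. *)
Lemma merged_all_merges R C :
  merged R C -> exists2 D, D \in all_merges R & snfm_equiv C D.
Proof.
suff H : merged R C -> exists S, [/\ S `<=` R, S != fset0 &
    snfm_equiv C (merge_set S)].
  move=> /H[S [SR S0 CS]]; exists (merge_set S) => //.
  by apply/all_mergesP; exists S.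
elim=> {C} [c cR | C D _ [S [SR S0 CS]] _ [T [TR T0 DT]]].
  exists [fset c]; split; first by rewrite fsub1set.
    by apply/fset0Pn; exists c; rewrite inE.
  by move=> v; rewrite !eval_merge_set !all_fset1.
exists (S `|` T); split; first by rewrite fsubUset SR.
  by rewrite fsetU_eq0 negb_and S0.
move=> v; have [C1 C2] := CS v; have [D1 D2] := DT v.
by rewrite /= C1 C2 D1 D2 !eval_merge_set !all_fsetU.
Qed.

(** This holds literally, not just up to equivalence: both sides of [merge_set S] are left-nested
    conjunctions without a unit, hence an iterated [merge]. *)
Lemma merged_merge_set R S : S `<=` R -> S != fset0 -> merged R (merge_set S).
Proof.
move/fsubsetP => SR /fset0Pn[x]; rewrite /merge_set.
(* From here on [S] is handled as a list; its member [x] rules out the empty one. *)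
have {SR} : {subset enum_fset S <= R} by [].
rewrite -[x \in S]/(x \in enum_fset S).
case: (enum_fset S) => [//|c s] + _ /= => /= sR.
have : merged R (snfm_of_step c) by apply/merged_step/sR/mem_head.
have {sR} : {subset s <= R} by move=> d sd; apply: sR; rewrite inE sd orbT.
rewrite [snfm_of_step c]surjective_pairing /=.
(* The sides of the first clause become arbitrary accumulators of the two left folds, as the
   induction on [s] requires. *)
move: (conj_seq _) (disj_seq _) => A B.
elim: s A B => [//|d s IHs] A B sR mAB.
apply: IHs => [e se|]; first by apply: sR; rewrite inE se orbT.
apply: (@merged_merge _ R (A, B) (snfm_of_step d)) => //.
exact/merged_step/sR/mem_head.
Qed.

Lemma all_merges_merged R C : C \in all_merges R -> merged R C.
Proof. by move/all_mergesP => [S [SR S0 ->]]; apply: merged_merge_set. Qed.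

Lemma prune_fsubset X : prune X `<=` X.
Proof. by apply/fsubsetP => C; rewrite !inE => /andP[]. Qed.

Lemma iter_prune_fsubset k X : iter k (@prune P) X `<=` X.
Proof.
elim: k => [|k IHk]; first exact: fsubset_refl.
exact: fsubset_trans (prune_fsubset _) IHk.
Qed.

Lemma prune_all_fsubset X : prune_all X `<=` X.
Proof. exact: iter_prune_fsubset. Qed.

Lemma prune_all_fixed X : prune (prune_all X) = prune_all X.
Proof. by rewrite /prune_all; case: ex_minnP => k /eqP. Qed.

Lemma naive_loop_merges R l C :
  C \in naive_loop R l -> merged R C /\ tautology (rhs_false l C).
Proof.
move/(fsubsetP (prune_all_fsubset _)); rewrite !inE => /andP[mC /tautP].
by split=> //; apply: all_merges_merged.
Qed.

Lemma naive_loop_is_loop R l :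
  naive_loop R l != fset0 -> is_loop R l (naive_loop R l).
Proof.
move=> N0; split=> // C NC; have [mC fC] := naive_loop_merges NC => //.
split=> //; apply/tautP.
(* Since the output is a fixed point of [prune], its members pass the covering test against the
   output itself. *)
by move: (NC); rewrite {1}/naive_loop -prune_all_fixed !inE => /andP[].
Qed.

(** The invariant of the run, with [L] a loop and [X] the current set of clauses. *)
Definition represented L X :=
  forall C, C \in L -> exists2 D, D \in X & snfm_equiv C D.

Lemma represented_filter_rhs R l L :
  is_loop R l L -> represented L (filter_rhs l (all_merges R)).
Proof.
move=> [_ mL tL] C LC; have [D mD CD] := merged_all_merges (mL C LC).
exists D => //; rewrite !inE mD; apply/tautP => v /=.
by rewrite -(CD v).2; have [/(_ v)] := tL C LC.
Qed.

Lemma represented_prune R l L X :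
  is_loop R l L -> represented L X -> represented L (prune X).
Proof.
move=> [_ _ tL] LX C LC; have [D XD CD] := LX C LC.
exists D => //; rewrite !inE XD; apply/tautP/rhs_coveredP => v.
rewrite -(CD v).2; have [_ /rhs_coveredP covC] := tL C LC.
(* The loop clause [C'] covering [C] at [v] is traded for its equivalent [D'] in [X], which covers
   [D] there. *)
move=> /covC[C' LC' C'1]; have [D' XD' CD'] := LX C' LC'.
by exists D' => //; rewrite -(CD' v).1.
Qed.

Lemma represented_naive_loop R l L :
  is_loop R l L -> represented L (naive_loop R l).
Proof.
(* The number of passes is generalized, as the invariant holds after any number of them. *)
move=> loopL; rewrite /naive_loop /prune_all; elim: (ex_minn _) => [|k]; first exact: represented_filter_rhs.
exact: represented_prune loopL.
Qed.

End Loops.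

Theorem theorem8 (P : choiceType) (R : {fset step_clause P}) (l : literal P) :
  (exists L : {fset snfm P}, is_loop R l L) <-> naive_loop R l <> fset0.
Proof.
split=> [[L loopL] N0 | /eqP N0].
  have [/fset0Pn[C LC] _ _] := loopL.
  by have [D] := represented_naive_loop loopL LC; rewrite N0 inE.
by exists (naive_loop R l); apply: naive_loop_is_loop.
Qed.
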